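(* Let $G$ be a finite, simple, connected, non-bipartite graph with $d+1$ distinct eigenvalues $\lambda_0>\lambda_1>\cdots>\lambda_d$ and preintersection numbers $\alpha_i,\beta_i,\gamma_i$ ($i=0,\ldots,d$). (i) If $\alpha_i\ge 0$ for $i=0,\ldots,d-1$, then $\gamma_d\ge -(\lambda_1+\cdots+\lambda_d)$, with equality if and only if $G$ is a (distance-regular) generalized Odd graph. (ii) If $G$ has odd-girth at least $2d-1$ and $\gamma_d=-(\lambda_1+\cdots+\lambda_d)$, then $G$ is a (distance-regular) generalized Odd graph.
   Context: Let $G$ be a finite, simple, connected graph on $n$ vertices with adjacency matrix $A$, whose distinct eigenvalues are $\lambda_0>\cdots>\lambda_d$ with multiplicities $m_0,\ldots,m_d$. On the space $\mathbb{R}_d[x]$ of real polynomials of degree at most $d$ use the scalar product $\langle p,q\rangle_G=\frac1n\operatorname{tr}(p(A)q(A))=\frac1n\sum_{i=0}^d m_i p(\lambda_i)q(\lambda_i)$. The predistance polynomials $p_0,\ldots,p_d$ are the unique orthogonal sequence with $\deg p_i=i$ and $\|p_i\|_G^2=p_i(\lambda_0)$. The preintersection numbers $\alpha_i,\beta_i,\gamma_i$ are the coefficients of the three-term recurrence $xp_i=\beta_{i-1}p_{i-1}+\alpha_ip_i+\gamma_{i+1}p_{i+1}$, $i=0,\ldots,d$, as functions on $\{\lambda_0,\ldots,\lambda_d\}$ (equivalently modulo $\prod_i (x-\lambda_i)$, which matters only for $i=d$), with conventions $\beta_{-1}=\gamma_{d+1}=0$, $p_{-1}=p_{d+1}=0$,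 $\gamma_0=\beta_d=0$. For vertices $u,v$ at distance $i$, let $c_i(u,v),a_i(u,v),b_i(u,v)$ be the number of neighbours of $v$ at distance $i-1$, $i$, $i+1$ from $u$, respectively. A graph of diameter $D$ is distance-regular if for each $i=0,\ldots,D$ these three numbers do not depend on the choice of $u,v$ at distance $i$. The odd-girth of a graph is the length of its shortest odd cycle. A generalized Odd graph is a distance-regular graph with diameter $D$ and odd-girth $2D+1$. *)

(* Defs.v *)
From mathcomp Require Export all_boot all_order all_algebra.

Set Implicit Arguments.
Unset Strict Implicit.
Unset Printing Implicit Defensive.

Import Order.TTheory GRing.Theory Num.Theory.

(* A finite simple graph is a symmetric irreflexive relation on a finType. *)

Definition graph_connected (T : finType) (e : rel T) : Prop :=
  forall u v : T, connect e u v.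

Definition bipartite (T : finType) (e : rel T) : Prop :=
  exists side : T -> bool, forall u v : T, e u v -> side u != side v.

Definition has_walk (T : finType) (e : rel T) (u v : T) (k : nat) : bool :=
  [exists p : k.-tuple T, path e u p && (last u p == v)].

(* Length of a shortest walk; a shortest walk has fewer than #|T| edges, and
   the value is #|T| when v is not reachable from u. *)
Definition dist (T : finType) (e : rel T) (u v : T) : nat :=
  find (has_walk e u v) (iota 0 #|T|).

Definition diameter (T : finType) (e : rel T) : nat :=
  \max_(u : T) \max_(v : T) dist e u v.

Definition c_num (T : finType) (e : rel T) (u v : T) : nat :=
  #|[set w | e v w & (dist e u w).+1 == dist e u v]|.

Definition a_num (T : finType) (e : rel T) (u v : T) : nat :=
  #|[set w | e v w & dist e u w == dist e u v]|.

Definition b_num (T : finType) (e : rel T) (u v : T) : nat :=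
  #|[set w | e v w & dist e u w == (dist e u v).+1]|.

Definition distance_regular (T : finType) (e : rel T) : Prop :=
  graph_connected e /\
  forall i, i <= diameter e ->
  forall u v u' v' : T, dist e u v = i -> dist e u' v' = i ->
  [/\ c_num e u v = c_num e u' v',
      a_num e u v = a_num e u' v' &
      b_num e u v = b_num e u' v'].

Definition odd_cycle (T : finType) (e : rel T) (c : seq T) : Prop :=
  [/\ ucycle e c, 2 < size c & odd (size c)].

Definition has_odd_girth (T : finType) (e : rel T) (g : nat) : Prop :=
  (exists2 c : seq T, odd_cycle e c & size c = g) /\
  (forall c : seq T, odd_cycle e c -> g <= size c).

Definition generalized_odd (T : finType) (e : rel T) : Prop :=
  distance_regular e /\ has_odd_girth e (2 * diameter e + 1).

Local Open Scope ring_scope.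

Definition adjmx (R : rcfType) (T : finType) (e : rel T) : 'M[R]_#|T| :=
  \matrix_(i, j) (e (enum_val i) (enum_val j))%:R.

(* horner_mx is only available for matrices of size n.+1. *)
Definition mx_eval (R : rcfType) (n : nat) (A : 'M[R]_n) (p : {poly R}) :
    'M[R]_n :=
  \sum_(i < size p) p`_i *: A ^+ i.

Definition graph_dotp (R : rcfType) (T : finType) (e : rel T)
    (p q : {poly R}) : R :=
  #|T|%:R^-1 * \tr (mx_eval (adjmx R e) p *m mx_eval (adjmx R e) q).

(* In what follows only the values at indices 0, ..., d of the sequences lam,
   p, alpha, beta, gamma are relevant. *)

Definition distinct_eigenvalues (R : rcfType) (T : finType) (e : rel T)
    (d : nat) (lam : nat -> R) : Prop :=
  (forall i j : nat, (i < j)%N -> (j <= d)%N -> lam j < lam i) /\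
  (forall x : R, eigenvalue (adjmx R e) x <-> exists2 i, (i <= d)%N & x = lam i).

Definition predistance_polys (R : rcfType) (T : finType) (e : rel T)
    (d : nat) (lam : nat -> R) (p : nat -> {poly R}) : Prop :=
  [/\ forall i, (i <= d)%N -> size (p i) = i.+1,
      forall i j, (i <= d)%N -> (j <= d)%N -> i <> j ->
        graph_dotp e (p i) (p j) = 0 &
      forall i, (i <= d)%N -> graph_dotp e (p i) (p i) = (p i).[lam 0%N]].

(* The recurrence
     x p_i = beta_{i-1} p_{i-1} + alpha_i p_i + gamma_{i+1} p_{i+1}
   holds on the spectrum only; p_{-1} = p_{d+1} = 0 is rendered by dropping the
   corresponding terms.  These conditions determine alpha_i, beta_i, gamma_i
   for all i <= d. *)
Definition preintersection_numbers (R : rcfType) (d : nat) (lam : nat -> R)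
    (p : nat -> {poly R}) (alpha beta gamma : nat -> R) : Prop :=
  [/\ gamma 0%N = 0, beta d = 0 &
      forall i j, (i <= d)%N -> (j <= d)%N ->
        lam j * (p i).[lam j] =
          (if i is k.+1 then beta k * (p k).[lam j] else 0)
          + alpha i * (p i).[lam j]
          + (if (i < d)%N then gamma i.+1 * (p i.+1).[lam j] else 0)].

(* Main.v *)
Require Import Defs.
From mathcomp Require Import all_boot all_order all_algebra.
From mathcomp Require Import complex lra ring zify.

(* Let B_i = p_i(A).  Comparing traces of the tridiagonal matrix of the
   recurrence and of diag(lam_0, ..., lam_d), which are similar, and using
   alpha_d + gamma_d = lam_0, gives
     gamma_d = - (lam_1 + ... + lam_d) + (alpha_0 + ... + alpha_(d-1)).
   If alpha_j = 0 for j < i then p_i has the parity of i; hence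
   alpha_0 = ... = alpha_(m-1) = 0 exactly when there is no closed walk of
   odd length < 2 m.

   Suppose alpha_i = 0 for all i < d.  Then B_i vanishes at the pairs (u, v)
   whose distance has the other parity than i, and alpha_d <> 0 because the graph
   is not bipartite.  At a pair at distance < d of the parity of d, the
   recurrence for i = d reads 0 = alpha_d (B_d)_uv, so B_d is supported on the
   pairs at distance d; by the recurrence, downwards, B_i is supported on the
   pairs at distance i.  The matrix J = B_0 + ... + B_d satisfies
   A J = lam_0 J and has unit diagonal, and (B_1)_uv is constant on edges, so
   the graph is regular; by the maximum principle J is the all-ones matrix.
   Thus B_i is the i-th distance matrix, and the recurrence is
   distance-regularity. *)

Set Implicit Arguments.
Unset Strict Implicit.
Unset Printing Implicit Defensive.

Import Order.TTheory GRing.Theory Num.Theory.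
Local Open Scope ring_scope.

(** * Polynomials evaluated at a matrix *)

Section MxEval.
Variable R : rcfType.

(** The ring morphism [horner_mx] supplies the algebraic laws below; in size 0 they are trivial
    because all matrices are equal. *)
Lemma mx_eval_horner n (A : 'M[R]_n.+1) q : mx_eval A q = horner_mx A q.
Proof.
rewrite /mx_eval -[in RHS](coefK q) poly_def raddf_sum /=.
by apply: eq_bigr => i _; rewrite linearZ /= rmorphXn /= horner_mx_X.
Qed.

Lemma mx_evalD n (A : 'M[R]_n) q r : mx_eval A (q + r) = mx_eval A q + mx_eval A r.
Proof.
case: n A => [|n] A; first by rewrite [LHS]flatmx0 [RHS]flatmx0.
by rewrite !mx_eval_horner rmorphD.
Qed.

Lemma mx_evalZ n (A : 'M[R]_n) a q : mx_eval A (a *: q) = a *: mx_eval A q.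
Proof.
case: n A => [|n] A; first by rewrite [LHS]flatmx0 [RHS]flatmx0.
by rewrite !mx_eval_horner linearZ.
Qed.

Lemma mx_evalM n (A : 'M[R]_n) q r : mx_eval A (q * r) = mx_eval A q *m mx_eval A r.
Proof.
case: n A => [|n] A; first by rewrite [LHS]flatmx0 [RHS]flatmx0.
by rewrite !mx_eval_horner rmorphM.
Qed.

Lemma mx_evalX n (A : 'M[R]_n) : mx_eval A 'X = A.
Proof.
case: n A => [|n] A; first by rewrite [LHS]flatmx0 [RHS]flatmx0.
by rewrite mx_eval_horner horner_mx_X.
Qed.

Lemma mx_evalC n (A : 'M[R]_n) a : mx_eval A a%:P = a%:M.
Proof.
case: n A => [|n] A; first by rewrite [LHS]flatmx0 [RHS]flatmx0.
by rewrite mx_eval_horner horner_mx_C.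
Qed.

Lemma mx_eval0 n (A : 'M[R]_n) : mx_eval A 0 = 0.
Proof. by rewrite mx_evalC raddf0. Qed.

Lemma mx_evalB n (A : 'M[R]_n) q r : mx_eval A (q - r) = mx_eval A q - mx_eval A r.
Proof. by rewrite mx_evalD -scaleN1r mx_evalZ scaleN1r. Qed.

Lemma mx_eval_sum n (A : 'M[R]_n) m (f : 'I_m -> {poly R}) :
  mx_eval A (\sum_i f i) = \sum_i mx_eval A (f i).
Proof. by apply: big_morph => [q r|]; [apply: mx_evalD | apply: mx_eval0]. Qed.

Lemma trmx_mx_eval n (A : 'M[R]_n) q : A^T = A -> (mx_eval A q)^T = mx_eval A q.
Proof.
move=> sA; rewrite /mx_eval raddf_sum /=; apply: eq_bigr => i _.
rewrite linearZ /=; congr (_ *: _); elim: (i : nat) => [|k IHk].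
  by rewrite !expr0 trmx1.
by rewrite {1}exprSr -[_ * A]/(_ *m A) trmx_mul sA IHk -[_ *m _]/(_ * _) -exprS.
Qed.

Lemma mx_eval_eigen n (A : 'M[R]_n) q a (v : 'rV_n) :
  v *m A = a *: v -> v *m mx_eval A q = q.[a] *: v.
Proof.
move=> va; rewrite /mx_eval horner_coef mulmx_sumr scaler_suml.
apply: eq_bigr => i _; rewrite -scalemxAr -scalerA; congr (_ *: _).
elim: (i : nat) => [|k IHk]; first by rewrite !expr0 mulmx1 scale1r.
by rewrite exprSr -[_ * A]/(_ *m A) mulmxA IHk -scalemxAl va scalerA -exprSr.
Qed.

(** The trace is the sum of the squares of all entries. *)
Lemma mxtrace_tr_mul_eq0 n (B : 'M[R]_n) : \tr (B^T *m B) = 0 -> B = 0.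
Proof.
rewrite /mxtrace => trB; apply/matrixP => i j; rewrite [RHS]mxE.
have ge0 k : 0 <= (B^T *m B) k k.
  by rewrite mxE sumr_ge0 // => l _; rewrite mxE -expr2 sqr_ge0.
have := psumr_eq0P (fun k _ => ge0 k) trB => /(_ j isT).
rewrite mxE => /psumr_eq0P sum0.
have /sum0/(_ i isT) : forall k, true -> 0 <= B^T j k * B k j.
  by move=> k _; rewrite mxE -expr2 sqr_ge0.
by rewrite mxE -expr2 => /eqP; rewrite sqrf_eq0 => /eqP.
Qed.

(* Real symmetric matrices are diagonalizable, by the spectral theorem over
   [R[i]]. *)
Lemma mx_eval_spectrum0 n (A : 'M[R]_n) q : A^T = A ->
  (forall x, eigenvalue A x -> q.[x] = 0) -> mx_eval A q = 0.
Proof.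
case: n A => [|n] A sA q0; first by rewrite [LHS]flatmx0.
rewrite mx_eval_horner; pose toC := real_complex R.
apply: (map_mx_inj (f := toC)); rewrite map_mx0 map_horner_mx.
set AC := map_mx toC A.
have hA : AC \is hermsymmx.
  apply: realsym_hermsym; first by apply/is_hermitianmxP; rewrite expr0 scale1r
    map_mx_id // map_trmx sA.
  by apply/mxOverP => i j; rewrite mxE; apply/complex_realP; exists (A i j).
have/hermitian_normalmx/orthomx_spectralP E := hA.
have uP := spectral_unit AC.
have q0D j : (map_poly toC q).[spectral_diag AC 0 j] = 0.
  have/mxOverP/(_ 0 j)/complex_realP[x Ex] := hermitian_spectral_diag_real hA.
  (* A diagonal entry is a real number [x], an eigenvalue of the complexified matrix with a row of
     the unitary matrix as eigenvector. It is an eigenvalue of [A] because both matrices have the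
     same characteristic polynomial. *)
  rewrite Ex horner_map q0 ?rmorph0 // eigenvalue_root_char.
  rewrite -(fmorph_root toC) map_char_poly -/AC -eigenvalue_root_char.
  apply/eigenvalueP; exists (row j (spectralmx AC)); last first.
    apply: contraTneq uP => r0; apply/negP => uP.
    have := mulmxV uP => /(congr1 (row j)); rewrite row_mul r0 mul0mx.
    by move/rowP/(_ j)/eqP; rewrite !mxE eqxx eq_sym oner_eq0.
  rewrite -row_mul {2}E !mulmxA mulmxV // mul1mx row_mul row_diag_mx.
  by rewrite -scalemxAl -rowE Ex.
rewrite E horner_mx_uconjC // horner_mx_diag.
rewrite (_ : map_mx _ _ = 0) ?raddf0 ?mulmx0 ?mul0mx //.
by apply/matrixP => i j; rewrite ord1 mxE q0D mxE.
Qed.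
End MxEval.

(** * Walks, distances and odd cycles *)

Section Walks.
Local Open Scope nat_scope.
Variables (T : finType) (e : rel T).

Lemma has_walkP u v k :
  reflect (exists p, [/\ size p = k, path e u p & last u p = v]) (has_walk e u v k).
Proof.
apply: (iffP existsP) => [[p /andP[pp /eqP lp]]|[p [/eqP sp pp lp]]].
  by exists p; rewrite size_tuple.
by exists (Tuple sp); rewrite /= pp lp eqxx.
Qed.

Lemma has_walk0 u v : has_walk e u v 0 = (u == v).
Proof.
apply/has_walkP/eqP => [[p [/size0nil-> _ <-]] //|->].
by exists [::].
Qed.

Lemma has_walkS u v k :
  has_walk e u v k.+1 = [exists w, has_walk e u w k && e w v].
Proof.
apply/has_walkP/existsP => [[p [sp pp lp]]|[w /andP[/has_walkP[p [sp pp lp]] ewv]]].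
  case/lastP: p sp pp lp => [|p x] //; rewrite size_rcons rcons_path last_rcons.
  move=> [sp] /andP[pp epx] <-; exists (last u p); rewrite epx andbT.
  by apply/has_walkP; exists p.
by exists (rcons p v); rewrite size_rcons rcons_path last_rcons sp pp lp.
Qed.

Lemma has_walk_cat u v w j k :
  has_walk e u v j -> has_walk e v w k -> has_walk e u w (j + k).
Proof.
move=> /has_walkP[p [sp pp lp]] /has_walkP[q [sq pq lq]]; apply/has_walkP.
by exists (p ++ q); rewrite size_cat sp sq cat_path pp last_cat lp pq lq.
Qed.

Lemma has_walk1 u v : has_walk e u v 1 = e u v.
Proof.
rewrite has_walkS; apply/existsP/idP => [[w]|euv].
  by rewrite has_walk0 => /andP[/eqP->].
by exists u; rewrite has_walk0 eqxx.
Qed.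

Lemma dist_le u v k : has_walk e u v k -> dist e u v <= k.
Proof.
move=> wk; case: (ltnP k #|T|) => [kT|]; last first.
  by apply: leq_trans; rewrite -[X in _ <= X](size_iota 0) find_size.
rewrite leqNgt; apply/negP => /(before_find 0).
by rewrite nth_iota // wk.
Qed.

Lemma leq_diameter u v : dist e u v <= diameter e.
Proof.
apply: (leq_trans (leq_bigmax v)).
exact: (leq_bigmax (F := fun u => \max_v dist e u v)).
Qed.

Hypothesis e_conn : graph_connected e.

(** A path without repeated vertices has fewer than [#|T|] edges, so the search defining [dist]
    succeeds. *)
Lemma dist_walk u v : has_walk e u v (dist e u v).
Proof.
have [p ep lp] := connectP (e_conn u v).
case/shortenP: ep lp => q eq uq _ lq.
have sq : size q < #|T| by have := max_card (mem (u :: q)); rewrite (card_uniqP uq).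
have := nth_find 0 (_ : has (has_walk e u v) (iota 0 #|T|)).
have hq : has (has_walk e u v) (iota 0 #|T|).
  apply/hasP; exists (size q); rewrite ?mem_iota //.
  by apply/has_walkP; exists q.
by move=> /(_ hq); rewrite nth_iota // -[X in _ < X](size_iota 0) -has_find.
Qed.

Lemma dist_eq0 u v : (dist e u v == 0) = (u == v).
Proof.
apply/eqP/eqP => [d0|->]; last by apply/eqP; rewrite -leqn0 dist_le ?has_walk0.
by apply/eqP; rewrite -has_walk0 -{1}d0 dist_walk.
Qed.

Lemma distxx u : dist e u u = 0.
Proof. by apply/eqP; rewrite dist_eq0. Qed.

Lemma dist_edge u v w : e v w -> dist e u w <= (dist e u v).+1.
Proof.
by move=> vw; rewrite -addn1 dist_le // (has_walk_cat (dist_walk u v)) ?has_walk1.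
Qed.

Hypothesis e_sym : symmetric e.

Lemma has_walk_sym u v k : has_walk e u v k = has_walk e v u k.
Proof.
wlog suff: u v / has_walk e u v k -> has_walk e v u k.
  by move=> H; apply/idP/idP; apply: H.
elim: k u v => [|k IHk] u v; first by rewrite !has_walk0 eq_sym.
rewrite has_walkS => /existsP[w /andP[/IHk uw wv]].
by rewrite -[k.+1]/(1 + k) (has_walk_cat _ uw) // has_walk1 e_sym.
Qed.

Lemma dist_edge_cases u v w : e v w ->
  [\/ (dist e u w).+1 = dist e u v, dist e u w = dist e u v |
      dist e u w = (dist e u v).+1].
Proof.
move=> vw; have := dist_edge u vw; rewrite e_sym in vw; have := dist_edge u vw.
case: (ltngtP (dist e u w) (dist e u v)) => [lt_wv|lt_vw|->] le1 le2.
- by apply: Or31; lia.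
- by apply: Or33; lia.
- exact: Or32.
Qed.

Lemma dist_pred u v k : dist e u v = k.+1 -> exists2 w, e v w & dist e u w = k.
Proof.
move=> duv; have := dist_walk u v; rewrite duv has_walkS => /existsP[w /andP[uw wv]].
exists w; first by rewrite e_sym.
have := dist_le uw; have := dist_edge u wv; lia.
Qed.

Lemma exists_dist u v k : k <= dist e u v -> exists w, dist e u w = k.
Proof.
move: {2}(dist e u v) (leqnn (dist e u v)) => m.
elim: m v => [|m IHm] v dm kd; first by exists v; lia.
have [<-|nk] := eqVneq (dist e u v) k; first by exists v.
case E: (dist e u v) => [|l]; first by lia.
by have [w _ dw] := dist_pred E; apply: (IHm w); lia.
Qed.

(* Cutting a closed walk at a repeated vertex leaves two closed walks, one of
   which is odd. *)
Lemma odd_walk_cycle (e_irr : irreflexive e) u k : has_walk e u u k -> odd k ->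
  exists2 c, odd_cycle e c & size c <= k.
Proof.
elim/ltn_ind: k u => k IHk u wk ok.
have [p [sp pp lp]] := has_walkP _ _ _ wk.
have [up|] := boolP (uniq p).
  (* The list [p] omits the starting point, but its last entry is [u], so [p] itself lists the
     cycle. Length 1 would be a loop. *)
  exists p; last by rewrite sp.
  split; rewrite ?sp //; last first.
    case: k sp ok wk {IHk} => [|[|[|k]]] //.
    by rewrite has_walk1 e_irr.
  rewrite /ucycle up andbT; case/lastP: p sp pp lp {up} => // p x _.
  by rewrite last_rcons => + xu; rewrite -xu /cycle; case: p => [|y p] /=;
    rewrite ?rcons_path ?last_rcons // => /andP[-> /andP[-> ->]].
move=> /(uniqPn u)[i [j [ij jk eij]]].
rewrite sp in jk; set x := nth u p i in eij.
have wij a b : a <= b < k -> has_walk e (nth u p a) (nth u p b) (b - a).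
  move=> /andP[ab bk]; elim: b ab bk => [|b IHb].
    by rewrite leqn0 => /eqP->; rewrite has_walk0.
  rewrite leq_eqVlt => /orP[/eqP->|]; first by rewrite subnn has_walk0.
  move=> ab bk; rewrite subSn // has_walkS; apply/existsP; exists (nth u p b).
  rewrite IHb ?(ltnW bk) //=; move/(pathP u)/(_ b.+1): pp; rewrite sp; exact.
have w0 b : b < k -> has_walk e u (nth u p b) b.+1.
  move=> bk; have := wij 0 b; rewrite subn0 bk => /(_ isT).
  apply: (@has_walk_cat _ _ _ 1); rewrite has_walk1.
  by move/(pathP u)/(_ 0): pp; rewrite sp; apply; lia.
have Lk : has_walk e x u (k.-1 - j).
  have plast : nth u p k.-1 = u by rewrite -sp nth_last.
  by have := wij j k.-1; rewrite -eij plast; apply; rewrite -ltnS prednK; lia.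
have oij := wij i j; rewrite -eij -/x in oij.
have {}oij : has_walk e x x (j - i) by apply: oij; lia.
have [od|ev] := boolP (odd (j - i)).
  have lt_ji : j - i < k by lia.
  by have [c oc sc] := IHk _ lt_ji x oij od; exists c => //; lia.
have wi : has_walk e u u (i.+1 + (k.-1 - j)).
  by apply: has_walk_cat Lk; apply: w0; lia.
have lt_k : i.+1 + (k.-1 - j) < k by lia.
have odk : odd (i.+1 + (k.-1 - j)) by lia.
by have [c oc sc] := IHk _ lt_k u wi odk; exists c => //; lia.
Qed.

Lemma odd_cycle_walk c : odd_cycle e c -> exists u, has_walk e u u (size c).
Proof.
case=> /andP[cc _] c2 _; case: c c2 cc => [|x c] // _ cc.
exists x; apply/has_walkP; exists (rcons c x).
by rewrite size_rcons last_rcons; split.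
Qed.

(** If no edge joined two vertices equidistant from [u], the parity of the distance to [u] would be
    a 2-colouring. *)
Lemma nonbipartite_edge : ~ bipartite e ->
  exists u v w, e v w /\ dist e u w = dist e u v.
Proof.
move=> nb; have [u _|T0] := pickP T; last first.
  by case: nb; exists (fun=> true) => u; have := T0 u.
have [/existsP[v /existsP[w /andP[vw /eqP E]]]|nE] :=
  boolP [exists v, exists w, e v w && (dist e u w == dist e u v)].
  by exists u, v, w.
case: nb; exists (fun v => odd (dist e u v)) => v w vw.
have [||] := dist_edge_cases u vw.
- by move=> <- /=; case: odd.
- move=> E; case/negP: nE; apply/existsP; exists v; apply/existsP; exists w.
  by rewrite vw E eqxx.
- by move=> -> /=; case: odd.
Qed.

(** Follow a geodesic from [u] to [v], the edge to [w], and a geodesic back to [u]. *)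
Lemma edge_dist_walk u v w : e v w -> dist e u w = dist e u v ->
  has_walk e u u (dist e u v).*2.+1.
Proof.
move=> vw E; have := has_walk_cat (dist_walk u v) (_ : has_walk e v w 1).
rewrite has_walk1 vw => /(_ isT) /has_walk_cat /(_ (_ : has_walk e w u (dist e u v))).
rewrite -{1}E has_walk_sym dist_walk => /(_ isT).
by rewrite addn1 addSn addnn.
Qed.

End Walks.

(** * Matrix entries indexed by vertices, and walks as entries of powers of the adjacency matrix *)

Section Entries.
Variables (R : rcfType) (T : finType) (e : rel T).
Hypothesis e_sym : symmetric e.

Definition entry (M : 'M[R]_#|T|) (u v : T) : R := M (enum_rank u) (enum_rank v).

Local Notation A := (adjmx R e).

Lemma sum_enum_rank (F : 'I_#|T| -> R) : \sum_i F i = \sum_(u : T) F (enum_rank u).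
Proof.
rewrite (reindex (@enum_rank T)) //=.
by exists enum_val => i _; [apply: enum_rankK | apply: enum_valK].
Qed.

Lemma eq_entry (M N : 'M[R]_#|T|) : entry M =2 entry N -> M = N.
Proof.
move=> MN; apply/matrixP => i j.
by have := MN (enum_val i) (enum_val j); rewrite /entry !enum_valK.
Qed.

Lemma tr_adjmx : A^T = A.
Proof. by apply/matrixP => i j; rewrite !mxE e_sym. Qed.

Lemma entryD M N u v : entry (M + N) u v = entry M u v + entry N u v.
Proof. by rewrite /entry mxE. Qed.

Lemma entryZ a M u v : entry (a *: M) u v = a * entry M u v.
Proof. by rewrite /entry mxE. Qed.

Lemma entry0 u v : entry 0 u v = 0.
Proof. by rewrite /entry mxE. Qed.

Lemma entry_sum I (r : seq I) (P : pred I) (F : I -> 'M_#|T|) u v :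
  entry (\sum_(i <- r | P i) F i) u v = \sum_(i <- r | P i) entry (F i) u v.
Proof. by rewrite /entry summxE. Qed.

Lemma entry1 u v : entry 1%:M u v = (u == v)%:R.
Proof. by rewrite /entry mxE (inj_eq enum_rank_inj). Qed.

Lemma entry_mul M N u v : entry (M *m N) u v = \sum_w entry M u w * entry N w v.
Proof. by rewrite /entry mxE sum_enum_rank. Qed.

Lemma entry_mulA M u v : entry (M *m A) u v = \sum_(w | e v w) entry M u w.
Proof.
rewrite entry_mul [RHS]big_mkcond /=; apply: eq_bigr => w _.
by rewrite {2}/entry mxE !enum_rankK e_sym; case: (e v w); rewrite (mulr1, mulr0).
Qed.

Lemma mxtrace_entry M : \tr M = \sum_u entry M u u.
Proof. exact: sum_enum_rank. Qed.

Lemma expmxS k : A ^+ k.+1 = A ^+ k *m A.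
Proof. exact: exprSr. Qed.

Lemma entry_exp_ge0 k u v : 0 <= entry (A ^+ k) u v.
Proof.
elim: k v => [|k IHk] v; first by rewrite expr0 entry1 ler0n.
by rewrite expmxS entry_mulA sumr_ge0.
Qed.

Lemma entry_exp_gt0 k u v : (0 < entry (A ^+ k) u v) = has_walk e u v k.
Proof.
elim: k v => [|k IHk] v.
  by rewrite expr0 entry1 has_walk0; case: eqP; rewrite ?ltr01 ?ltxx.
rewrite expmxS entry_mulA has_walkS; apply/idP/existsP => [|[w /andP[uw wv]]].
  rewrite lt0r => /andP[+ _]; rewrite psumr_neq0 => [/hasP[w _ /andP[vw gt0]]|w _].
    by exists w; rewrite -IHk gt0 e_sym.
  exact: entry_exp_ge0.
rewrite (bigD1 w) 1?e_sym //=; apply: ltr_wpDr; last by rewrite IHk.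
by apply: sumr_ge0 => *; apply: entry_exp_ge0.
Qed.

Lemma entry_exp_eq0 k u v : (entry (A ^+ k) u v == 0) = ~~ has_walk e u v k.
Proof. by rewrite -entry_exp_gt0 lt0r entry_exp_ge0 andbT negbK. Qed.

Lemma mxtrace_exp_eq0 k :
  (\tr (A ^+ k) == 0) = [forall u, ~~ has_walk e u u k].
Proof.
rewrite mxtrace_entry; apply/eqP/forallP => [/psumr_eq0P + u|nw].
  move=> /(_ _ u isT) E; rewrite -entry_exp_eq0 E // => v _.
  exact: entry_exp_ge0.
by apply: big1 => u _; apply/eqP; rewrite entry_exp_eq0.
Qed.

Lemma entry_mx_eval q u v :
  entry (mx_eval A q) u v = \sum_(i < size q) q`_i * entry (A ^+ i) u v.
Proof. by rewrite entry_sum; apply: eq_bigr => i _; rewrite entryZ. Qed.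

(** Every power of [A] occurring in [q(A)] is too low for a walk to reach [v] from [u]. *)
Lemma entry_mx_eval_dist_gt (q : {poly R}) u v : (size q <= dist e u v)%N ->
  entry (mx_eval A q) u v = 0.
Proof.
move=> sq; rewrite entry_mx_eval; apply: big1 => i _.
have/eqP-> : entry (A ^+ i) u v == 0; last by rewrite mulr0.
rewrite entry_exp_eq0; apply/negP => /dist_le; have := ltn_ord i; lia.
Qed.

Lemma entry_mx_eval_dist_eq (q : {poly R}) u v : size q = (dist e u v).+1 ->
  entry (mx_eval A q) u v = lead_coef q * entry (A ^+ dist e u v) u v.
Proof.
move=> sq; rewrite entry_mx_eval sq big_ord_recr /= lead_coefE sq big1 ?add0r //.
move=> i _; have/eqP-> : entry (A ^+ i) u v == 0; last by rewrite mulr0.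
rewrite entry_exp_eq0; apply/negP => /dist_le; have := ltn_ord i; lia.
Qed.

End Entries.

(** * Predistance polynomials, their recurrence, and the trace identity *)

Section Predistance.
Variables (R : rcfType) (T : finType) (e : rel T).
Variables (d : nat) (lam : nat -> R) (p : nat -> {poly R}).
Variables (alpha beta gamma : nat -> R).
Hypotheses (e_sym : symmetric e) (e_irr : irreflexive e).
Hypothesis e_conn : graph_connected e.
Hypothesis lamP : distinct_eigenvalues e d lam.
Hypothesis pP : predistance_polys e d lam p.
Hypothesis abcP : preintersection_numbers d lam p alpha beta gamma.

Local Notation A := (adjmx R e).
Local Notation B i := (mx_eval A (p i)).
Local Notation N i := (\tr (B i *m B i)).

Lemma size_p i : (i <= d)%N -> size (p i) = i.+1.
Proof. by case: pP => + _ _; apply. Qed.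

Lemma mx_eval_lam0 (q : {poly R}) :
  (forall j, (j <= d)%N -> q.[lam j] = 0) -> mx_eval A q = 0.
Proof.
move=> q0; apply: mx_eval_spectrum0; first exact: tr_adjmx.
by move=> x /(lamP.2 x)[j jd ->]; apply: q0.
Qed.

Lemma mx_eval_eq0_lam (q : {poly R}) j : (j <= d)%N -> mx_eval A q = 0 -> q.[lam j] = 0.
Proof.
move=> jd q0; have/eigenvalueP[v va v0] : eigenvalue A (lam j).
  by apply/lamP.2; exists j.
have := mx_eval_eigen q va; rewrite q0 mulmx0 => /esym/eqP.
by rewrite scaler_eq0 (negPf v0) orbF => /eqP.
Qed.

Lemma small_poly_lam0 (q : {poly R}) : (size q <= d.+1)%N ->
  (forall j, (j <= d)%N -> q.[lam j] = 0) -> q = 0.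
Proof.
move=> sq q0; apply/eqP; apply: contraTT sq => /max_poly_roots H.
rewrite -ltnNge -[d.+1](size_iota 0) -(size_map lam); apply: H.
  by apply/allP => x /mapP[j]; rewrite mem_iota => jd ->; apply/rootP/q0; lia.
rewrite map_inj_in_uniq ?iota_uniq // => i j; rewrite !mem_iota => id jd eij.
by case: (ltngtP i j) => // /lamP.1 => lt; have := lt ltac:(lia); rewrite eij ltxx.
Qed.

Lemma small_poly_mx0 (q : {poly R}) : (size q <= d.+1)%N -> mx_eval A q = 0 -> q = 0.
Proof.
by move=> sq q0; apply: small_poly_lam0 => // j jd; apply: mx_eval_eq0_lam.
Qed.

Lemma trmxB i : (B i)^T = B i.
Proof. exact/trmx_mx_eval/tr_adjmx. Qed.

Lemma normB_neq0 i : (i <= d)%N -> N i != 0.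
Proof.
move=> id; apply/eqP; rewrite -{1}trmxB => /mxtrace_tr_mul_eq0/small_poly_mx0.
rewrite size_p // ltnS => /(_ id) pi0.
by have := size_p id; rewrite pi0 size_poly0.
Qed.

Lemma cardT_neq0 : #|T|%:R != 0 :> R.
Proof.
rewrite pnatr_eq0; apply/eqP => T0.
have/eigenvalueP[v _ /eqP[]] : eigenvalue A (lam 0) by apply/lamP.2; exists 0%N.
by apply/rowP => i; have : (i < 0)%N by rewrite -[X in (_ < X)%N]T0.
Qed.

Lemma traceB_orth i j : (i <= d)%N -> (j <= d)%N -> i != j -> \tr (B i *m B j) = 0.
Proof.
move=> id jd /eqP ij; have [_ /(_ i j id jd ij) /eqP + _] := pP.
by rewrite mulf_eq0 invr_eq0 (negPf cardT_neq0) => /eqP.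
Qed.

Lemma normB i : (i <= d)%N -> N i = #|T|%:R * (p i).[lam 0%N].
Proof.
move=> id; have [_ _ /(_ i id) <-] := pP.
by rewrite mulrA divff ?mul1r // cardT_neq0.
Qed.

(** An identity on the spectrum is an identity of matrices, so this also covers [i = d]. *)
Lemma recB i : (i <= d)%N -> B i *m A =
  (if i is k.+1 then beta k *: B k else 0) + alpha i *: B i
  + (if (i < d)%N then gamma i.+1 *: B i.+1 else 0).
Proof.
move=> id; pose q := (if i is k.+1 then beta k *: p k else 0) + alpha i *: p i
  + (if (i < d)%N then gamma i.+1 *: p i.+1 else 0).
have -> : B i *m A = mx_eval A q.
  rewrite -{2}[A]mx_evalX -mx_evalM; apply/eqP; rewrite -subr_eq0 -mx_evalB.
  apply/eqP/mx_eval_lam0 => j jd; rewrite hornerD hornerN hornerM hornerX /q.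
  have [_ _ /(_ i j id jd)] := abcP; rewrite mulrC => ->.
  by case: (i) => [|k]; case: ifP => _; rewrite !hornerE /= subrr.
rewrite /q !mx_evalD mx_evalZ.
by case: (i) => [|k]; case: ifP => _; rewrite ?mx_evalZ ?mx_eval0.
Qed.

(** For [i < d] both sides have degree at most [d] and agree at [d + 1] points, so they are equal as
    polynomials and not only on the spectrum. *)
Lemma recp i : (i < d)%N -> 'X * p i =
  (if i is k.+1 then beta k *: p k else 0) + alpha i *: p i + gamma i.+1 *: p i.+1.
Proof.
move=> id; apply/eqP; rewrite -subr_eq0; apply/eqP/small_poly_lam0 => [|j jd].
  rewrite (leq_trans (size_polyD _ _)) // size_polyN geq_max; apply/andP; split.
    by rewrite (leq_trans (size_polyMleq _ _)) // size_polyX size_p //; lia.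
  rewrite (leq_trans (size_polyD _ _)) // geq_max; apply/andP; split; last first.
    by rewrite (leq_trans (size_scale_leq _ _)) ?size_p.
  rewrite (leq_trans (size_polyD _ _)) // geq_max; apply/andP; split; last first.
    by rewrite (leq_trans (size_scale_leq _ _)) ?size_p //; lia.
  case: i id => [|k] kd; first by rewrite size_poly0.
  by rewrite (leq_trans (size_scale_leq _ _)) ?size_p //; lia.
have [_ _ /(_ i j (ltnW id) jd)] := abcP.
rewrite hornerD hornerN hornerM hornerX id => ->.
by case: (i) => [|k]; rewrite !hornerE /= subrr.
Qed.

(** Only the term with [p i.+1] can match the degree of ['X * p i]. *)
Lemma gamma_neq0 i : (i < d)%N -> gamma i.+1 != 0.
Proof.
move=> id; apply/eqP => g0; have /(congr1 (fun q : {poly R} => size q)) := recp id.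
have p0 : p i != 0 by rewrite -size_poly_gt0 size_p // ltnW.
rewrite g0 scale0r addr0 mulrC size_mulX // size_p 1?ltnW // => E.
have : (i.+2 <= i.+1)%N; last by rewrite ltnn.
rewrite {1}E (leq_trans (size_polyD _ _)) // geq_max; apply/andP; split; last first.
  by rewrite (leq_trans (size_scale_leq _ _)) // size_p // ltnW.
case: i id {g0 E p0} => [|k] kd; first by rewrite size_poly0.
by rewrite (leq_trans (size_scale_leq _ _)) ?size_p //; lia.
Qed.

(** Since [A] is symmetric, the scalar product of [x p_i] with [p_(i+1)] can be computed with the
    recurrence of either factor. *)
Lemma beta_gamma i : (i < d)%N -> beta i * N i = gamma i.+1 * N i.+1.
Proof.
move=> id.
have : \tr (B i.+1 *m A *m B i) = \tr (B i *m A *m B i.+1).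
  by rewrite -mxtrace_tr !trmx_mul !trmxB tr_adjmx // mulmxA.
rewrite !recB ?(ltnW id) // id !mulmxDl !mxtraceD -!scalemxAl !mxtraceZ.
have -> : \tr (B i.+1 *m B i) = 0 by apply: traceB_orth; lia.
have -> : \tr (B i *m B i.+1) = 0 by apply: traceB_orth; lia.
rewrite !mulr0 !addr0.
have -> : \tr ((if (i.+1 < d)%N then gamma i.+2 *: B i.+2 else 0) *m B i) = 0.
  case: ifP => i2d; last by rewrite mul0mx mxtrace0.
  by rewrite -scalemxAl mxtraceZ traceB_orth ?mulr0 //; lia.
rewrite addr0 => ->.
case: i id => [|k] kd; rewrite ?mul0mx ?mxtrace0 ?add0r //.
by rewrite -scalemxAl mxtraceZ traceB_orth ?mulr0 ?add0r //; lia.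
Qed.

Lemma beta_neq0 i : (i < d)%N -> beta i != 0.
Proof.
move=> id; apply/eqP => b0; have := beta_gamma id.
by move/eqP; rewrite b0 mul0r eq_sym mulf_eq0 (negPf (gamma_neq0 id))
  (negPf (normB_neq0 id)).
Qed.

(** Evaluate the recurrence at [lam 0], where the normalization turns each value [p_k(lam_0)] into a
    norm; [beta_gamma] then brings all terms back to [N i]. *)
Lemma abc_sum i : (i <= d)%N -> alpha i + beta i + gamma i = lam 0%N.
Proof.
move=> id; apply: (mulIf (normB_neq0 id)).
have [g0 bd /(_ i 0%N id (leq0n _)) E] := abcP.
rewrite [in RHS]normB // mulrCA E !mulrDr !mulrDl addrAC [alpha _ * _ + _]addrC.
congr (_ + _ + _).
- case: i id E => [|k] kd E; first by rewrite g0 mul0r mulr0.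
  by rewrite -beta_gamma // mulrCA -normB //; lia.
- by rewrite mulrCA -normB.
- case: ifP => id'; first by rewrite mulrCA -normB // beta_gamma.
  by rewrite (_ : i = d) ?bd ?mul0r ?mulr0 //; lia.
Qed.

Lemma freeB (v : 'rV[R]_d.+1) : \sum_i v 0 i *: B i = 0 -> v = 0.
Proof.
move=> v0; apply/rowP => j; rewrite mxE.
have jd : (j <= d)%N by rewrite -ltnS.
have /eqP : \tr ((\sum_i v 0 i *: B i) *m B j) = 0 by rewrite v0 mul0mx mxtrace0.
rewrite mulmx_suml raddf_sum /= (bigD1 j) //= big1 => [|i ij].
  rewrite -scalemxAl mxtraceZ addr0 mulf_eq0.
  by rewrite (negPf (normB_neq0 jd)) orbF => /eqP.
by rewrite -scalemxAl mxtraceZ traceB_orth ?mulr0 // -ltnS.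
Qed.

(* On the spectrum the recurrence says that the tridiagonal matrix of the
   preintersection numbers is similar to [diag (lam_0, ..., lam_d)]. *)
Lemma alpha_sum : \sum_(i < d.+1) alpha i = \sum_(i < d.+1) lam i.
Proof.
pose P : 'M[R]_d.+1 := \matrix_(i, j) (p i).[lam j].
pose D : 'M[R]_d.+1 := diag_mx (\row_j lam j).
pose L : 'M[R]_d.+1 := \matrix_(i, j)
  (beta j *+ (i == j.+1 :> nat) + alpha i *+ (i == j) + gamma j *+ (j == i.+1 :> nat)).
(* A linear relation between the rows of [P] is a combination of the [p i] vanishing on the
   spectrum, which [freeB] excludes. *)
have uP : P \in unitmx.
  rewrite -row_free_unit; apply: inj_row_free => v vP.
  apply: freeB; under eq_bigr => i _ do rewrite -mx_evalZ.
  rewrite -mx_eval_sum; apply: mx_eval_lam0 => j jd.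
  move/rowP/(_ (inord j)): vP; rewrite !mxE => <-; rewrite horner_sum.
  by apply: eq_bigr => i _; rewrite mxE hornerZ inordK.
have PD : P *m D = L *m P.
  apply/matrixP => i j; rewrite mul_mx_diag !mxE mulrC.
  have [_ _ /(_ i j (ltn_ord i) (ltn_ord j)) ->] := abcP.
  transitivity (\sum_(k < d.+1) (beta k * (p k).[lam j]) *+ (i == k.+1 :> nat)
    + \sum_(k < d.+1) (alpha i * (p k).[lam j]) *+ (i == k)
    + \sum_(k < d.+1) (gamma k * (p k).[lam j]) *+ (k == i.+1 :> nat)); last first.
    rewrite -!big_split /=; apply: eq_bigr => k _.
    by rewrite !mxE !mulrDl !mulrnAl.
  congr (_ + _ + _).
  - case: i => [[|k] kd] /=; first by rewrite big1.
    rewrite (bigD1 (Ordinal (ltnW kd))) //= eqxx big1 ?addr0 // => l.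
    by rewrite -val_eqE /= eqSS eq_sym => /negPf->.
  - rewrite (bigD1 i) //= eqxx big1 ?addr0 // => l.
    by rewrite eq_sym => /negPf->.
  - case: ifP => [id|nid].
      rewrite (bigD1 (Ordinal (id : i.+1 < d.+1)%N)) //= eqxx big1 ?addr0 // => l.
      by rewrite -val_eqE /= => /negPf->.
    rewrite big1 // => l _.
    by case: eqP => // E; have := ltn_ord l; lia.
have /(congr1 mxtrace) : L = P *m D *m invmx P by rewrite PD mulmxK.
rewrite mxtrace_mulC mulmxA mulVmx // mul1mx mxtrace_diag /mxtrace.
under eq_bigr => i _.
  rewrite mxE eqxx ltn_eqF // !mulr0n mulr1n add0r addr0; over.
by move=> ->; apply: eq_bigr => i _; rewrite mxE.
Qed.

Lemma gamma_d : gamma d = - (\sum_(1 <= i < d.+1) lam i) + \sum_(i < d) alpha i.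
Proof.
have := alpha_sum; rewrite big_ord_recr -(big_mkord xpredT lam) big_ltn //=.
by have := abc_sum (leqnn d); have [_ -> _] := abcP; lra.
Qed.

(** * Vanishing [alpha], parity, and traces of odd powers *)

Lemma p_parity i : (i <= d)%N -> (forall j, (j < i)%N -> alpha j = 0) ->
  forall k, odd (k + i) -> (p i)`_k = 0.
Proof.
elim/ltn_ind: i => -[|i] IHi id al0 k ok.
  by apply: nth_default; rewrite size_p //; lia.
(* Without the [alpha] term, the next polynomial is a combination of ['X * p i] and [p i.-1], which
   both have the parity of [i.+1]. *)
apply: (mulfI (gamma_neq0 id)); rewrite mulr0.
have /(congr1 (fun q : {poly R} => q`_k)) := recp id.
rewrite al0 // scale0r addr0 coefXM !coefD coefZ.
have -> : (if k == 0%N then 0 else (p i)`_k.-1) = 0.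
  case: k ok => //= k ok; apply: IHi; try lia.
  by move=> j ji; apply: al0; lia.
case: i IHi id al0 ok => [|i] IHi id al0 ok; first by rewrite coef0 add0r.
rewrite coefZ IHi ?mulr0 ?add0r //; try lia.
by move=> j ji; apply: al0; lia.
Qed.

Lemma mxtrace_mul3 (q : {poly R}) : \tr (mx_eval A q *m A *m mx_eval A q) =
  \sum_(k < size q) \sum_(l < size q) q`_k * q`_l * \tr (A ^+ (k + l).+1).
Proof.
rewrite {1}/mx_eval !mulmx_suml raddf_sum; apply: eq_bigr => k _ /=.
rewrite /mx_eval mulmx_sumr raddf_sum; apply: eq_bigr => l _ /=.
rewrite -scalemxAr -!scalemxAl !mxtraceZ mulrCA mulrA -expmxS.
by rewrite -[_ *m _]/(_ * _) -exprD addSn.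
Qed.

(** This exhibits [alpha i] as a Rayleigh quotient. *)
Lemma traceBAB i : (i <= d)%N -> \tr (B i *m A *m B i) = alpha i * N i.
Proof.
move=> id; rewrite recB // !mulmxDl !mxtraceD -!scalemxAl !mxtraceZ.
have -> : \tr ((if i is k.+1 then beta k *: B k else 0) *m B i) = 0.
  case: i id => [|k] kd; first by rewrite mul0mx mxtrace0.
  by rewrite -scalemxAl mxtraceZ traceB_orth ?mulr0 //; lia.
case: ifP => id'; last by rewrite mul0mx mxtrace0 add0r addr0.
have o : \tr (B i.+1 *m B i) = 0 by apply: traceB_orth; lia.
by rewrite -scalemxAl mxtraceZ o mulr0 addr0 add0r.
Qed.

(** By parity, [x p_i^2] contains only odd powers of [x]. Those below [2i + 1] have trace zero by
    hypothesis, which leaves the leading term. *)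
Lemma alpha_trace i : (i <= d)%N -> (forall j, (j < i)%N -> alpha j = 0) ->
  (forall j, (j < i)%N -> \tr (A ^+ j.*2.+1) = 0) ->
  alpha i * N i = lead_coef (p i) ^+ 2 * \tr (A ^+ i.*2.+1).
Proof.
move=> id al0 tr0; rewrite -traceBAB // mxtrace_mul3 lead_coefE size_p //=.
have F0 (k l : 'I_i.+1) : (k != ord_max) || (l != ord_max) ->
    (p i)`_k * (p i)`_l * \tr (A ^+ (k + l).+1) = 0.
  rewrite -!val_eqE /= => kl.
  have [ok|ek] := boolP (odd (k + i)); first by rewrite p_parity ?mul0r.
  have [ol|el] := boolP (odd (l + i)); first by rewrite (p_parity id al0 ol) mulr0 mul0r.
  have -> : (k + l)%N = (k + l)./2.*2.
    by rewrite -[LHS]odd_double_half (_ : odd (k + l) = false) //; lia.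
  by rewrite tr0 ?mulr0 //; have := ltn_ord k; have := ltn_ord l; lia.
rewrite (bigD1 ord_max) //= (bigD1 ord_max) //= -expr2 addnn.
rewrite !big1 ?addr0 // => [k kM|l lM]; last first.
  by have := F0 ord_max l; rewrite lM orbT => /(_ isT).
by apply: big1 => l _; apply: F0; rewrite kM.
Qed.

(** Inductively, [alpha m] and the trace of the power [2m + 1] agree up to nonzero factors. *)
Lemma alpha0_traces m : (m <= d.+1)%N -> (forall j, (j < m)%N -> alpha j = 0) <->
  (forall j, (j < m)%N -> \tr (A ^+ j.*2.+1) = 0).
Proof.
elim: m => [|m IHm] md; first by split=> _ j; rewrite ltn0.
have {}IHm := IHm (ltnW md).
have lt_split (P : nat -> Prop) : (forall j, (j < m.+1)%N -> P j) <->
    (forall j, (j < m)%N -> P j) /\ P m.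
  split=> [H|[H Hm] j]; first by split=> [j jm|]; apply: H; rewrite // ltnW.
  by rewrite ltnS leq_eqVlt => /orP[/eqP->|/H].
have lead0 : lead_coef (p m) != 0 by rewrite lead_coef_eq0 -size_poly_gt0 size_p.
rewrite !lt_split; split=> -[H0 Hm].
- have tr0 := IHm.1 H0; split => //.
  have /eqP := alpha_trace md H0 tr0.
  by rewrite Hm mul0r eq_sym mulf_eq0 sqrf_eq0 (negPf lead0) => /eqP.
- have al0 := IHm.2 H0; split => //.
  have /eqP := alpha_trace md al0 H0.
  by rewrite Hm mulr0 mulf_eq0 (negPf (normB_neq0 md)) orbF => /eqP.
Qed.

(** A monic polynomial of degree [d + 1] annihilates [A], whereas at a pair at distance [d + 1] its
    value would have a positive entry. *)
Lemma dist_le_d u v : (dist e u v <= d)%N.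
Proof.
rewrite leqNgt; apply/negP => /(exists_dist e_conn e_sym)[w dw].
pose q := \prod_(i < d.+1) ('X - (lam i)%:P).
have sq : size q = (dist e u w).+1.
  by rewrite size_prod_XsubC /index_enum -enumT size_enum_ord dw.
have := entry_mx_eval_dist_eq e_sym sq.
rewrite mx_eval_lam0 => [|j jd].
  rewrite entry0 (monicP (monic_prod_XsubC _ _ _)) mul1r => /esym/eqP.
  by rewrite entry_exp_eq0 // dist_walk.
by rewrite horner_prod (bigD1 (Ordinal (jd : j < d.+1)%N)) //= !hornerE subrr mul0r.
Qed.

Lemma sumB_mulA : (\sum_(i < d.+1) B i) *m A = lam 0%N *: \sum_(i < d.+1) B i.
Proof.
have [g0 bd _] := abcP.
rewrite mulmx_suml scaler_sumr.
transitivity (\sum_(i < d.+1) beta i *: B i + \sum_(i < d.+1) alpha i *: B i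
   + \sum_(i < d.+1) gamma i *: B i); last first.
  rewrite -!big_split; apply: eq_bigr => i _ /=.
  by rewrite -!scalerDl -(abc_sum (ltn_ord i : i <= d)%N); congr (_ *: _); ring.
rewrite (eq_bigr _ (fun (i : 'I_d.+1) _ => @recB i (ltn_ord i))) !big_split /=.
(* Shifting the index loses only the boundary terms, which vanish by [beta d = 0] and
   [gamma 0 = 0]. *)
congr (_ + _ + _).
  by rewrite big_ord_recl add0r [RHS]big_ord_recr /= bd scale0r addr0.
rewrite big_ord_recr /= ltnn addr0 [RHS]big_ord_recl g0 scale0r add0r.
by apply: eq_bigr => i _; rewrite ltn_ord.
Qed.

(** The polynomial [p 0] is a nonzero constant [c], and its normalization reads [c * c = c]. *)
Lemma B0 : B 0%N = 1%:M.
Proof.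
have /eqP/size_poly1P[c c0 E] := size_p (leq0n d).
have := normB (leq0n d); rewrite E mx_evalC hornerC -scalar_mxM mxtrace_scalar.
rewrite -[c * c *+ _]mulr_natl => /(mulfI cardT_neq0).
by rewrite -[RHS]mulr1 => /(mulfI c0)->.
Qed.

Lemma girth_alpha0 g m : has_odd_girth e g -> (m <= d.+1)%N -> (m.*2 <= g)%N ->
  forall j, (j < m)%N -> alpha j = 0.
Proof.
move=> [_ girth] md mg; apply: (alpha0_traces md).2 => j jm; apply/eqP.
rewrite mxtrace_exp_eq0 //; apply/forallP => u; apply/negP => wu.
have odj : odd j.*2.+1 by rewrite /= odd_double.
have [c oc sc] := odd_walk_cycle e_irr wu odj.
by have := girth c oc; lia.
Qed.

(** * Distance-regular graphs: the diameter is at least [d] *)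

Section DistanceRegular.
Hypothesis e_dr : distance_regular e.

(* Meaningful only for matrices whose entries depend on the distance alone. *)
Definition at_dist (M : 'M[R]_#|T|) (k : nat) : R :=
  if [pick x : T * T | dist e x.1 x.2 == k] is Some x then entry M x.1 x.2 else 0.

Definition dist_invariant (M : 'M[R]_#|T|) : Prop :=
  forall u v, entry M u v = at_dist M (dist e u v).

Lemma dist_invariantP (M : 'M[R]_#|T|) :
  (forall u v u' v', dist e u v = dist e u' v' -> entry M u v = entry M u' v') ->
  dist_invariant M.
Proof.
move=> inv u v; rewrite /at_dist; case: pickP => [[x y] /= /eqP E|/(_ (u, v))].
  exact: inv.
by rewrite eqxx.
Qed.

Lemma dist_invariant_mulA M : dist_invariant M -> dist_invariant (M *m A).
Proof.
move=> inv; apply: dist_invariantP.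
(* At distance 0 the truncated predecessor is harmless, as [c_num] is 0 there. *)
have mulE u v : entry (M *m A) u v = at_dist M (dist e u v).-1 * (c_num e u v)%:R
    + at_dist M (dist e u v) * (a_num e u v)%:R
    + at_dist M (dist e u v).+1 * (b_num e u v)%:R.
  have cardE (Q : pred T) :
      #|[set w | e v w & Q w]|%:R = \sum_(w | e v w) (Q w)%:R :> R.
    rewrite -sum1_card natr_sum big_mkcond [RHS]big_mkcond /=.
    by apply: eq_bigr => w _; rewrite inE; case: (e v w) => //=; case: (Q w).
  rewrite entry_mulA // !cardE !mulr_sumr -!big_split /=; apply: eq_bigr => w vw.
  rewrite inv.
  have [E|E|E] := dist_edge_cases e_conn e_sym u vw.
  - rewrite -E /= eqxx (ltn_eqF (ltnSn _)) (ltn_eqF (leqW (ltnSn _))).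
    by rewrite mulr1 !mulr0 !addr0.
  - rewrite E eqxx (gtn_eqF (ltnSn _)) (ltn_eqF (ltnSn _)).
    by rewrite mulr1 !mulr0 addr0 add0r.
  - rewrite E eqxx (gtn_eqF (ltnSn _)) (gtn_eqF (leqW (ltnSn _))).
    by rewrite mulr1 !mulr0 !add0r.
move=> u v u' v' E; rewrite !mulE.
by have [-> -> ->] := e_dr.2 _ (leq_diameter e u v) u v u' v' erefl (esym E); rewrite E.
Qed.

Lemma dist_invariant_mx_eval (q : {poly R}) : dist_invariant (mx_eval A q).
Proof.
have invA k : dist_invariant (A ^+ k).
  elim: k => [|k IHk]; last by rewrite expmxS; apply: dist_invariant_mulA.
  apply: dist_invariantP => u v u' v' E.
  by rewrite expr0 !entry1 -!(dist_eq0 e_conn) E.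
apply: dist_invariantP => u v u' v' E; rewrite !entry_mx_eval.
by apply: eq_bigr => i _; rewrite !invA E.
Qed.

(** The [d + 1] independent matrices [B i] are functions of the distance, and these form a space of
    dimension at most [diameter e + 1]. *)
Lemma d_le_diameter : (d <= diameter e)%N.
Proof.
pose F : 'M[R]_(d.+1, (diameter e).+1) := \matrix_(i, j) at_dist (B i) j.
suff : row_free F by rewrite -row_leq_rank => /leq_trans/(_ (rank_leq_col F)).
apply: inj_row_free => v vF; apply: freeB; apply: eq_entry => x y.
rewrite entry0 entry_sum.
have /rowP/(_ (inord (dist e x y))) := vF; rewrite !mxE => vF0.
rewrite -[RHS]vF0; apply: eq_bigr => i _.
by rewrite entryZ dist_invariant_mx_eval mxE inordK // ltnS leq_diameter.
Qed.

End DistanceRegular.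

Lemma generalized_odd_alpha0 : generalized_odd e ->
  forall j, (j < d)%N -> alpha j = 0.
Proof.
move=> [e_dr girth]; apply: (girth_alpha0 girth); first exact: leqnSn.
by have := d_le_diameter e_dr; lia.
Qed.

(** * From vanishing [alpha] to a generalized Odd graph *)

Section AlphaZero.
Hypothesis alpha0 : forall i, (i < d)%N -> alpha i = 0.
Hypothesis nbip : ~ bipartite e.

Lemma no_odd_walk u k : odd k -> (k < d.*2)%N -> ~~ has_walk e u u k.
Proof.
move=> ok kd; have /eqP : \tr (A ^+ k) = 0.
  have -> : k = k./2.*2.+1 by rewrite -[LHS]odd_double_half ok.
  by apply: (alpha0_traces (leqnSn d)).1 => //; lia.
by rewrite mxtrace_exp_eq0 // => /forallP/(_ u).
Qed.

(** Otherwise there would be no closed walk of odd length up to [2d + 1], but an edge between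
    vertices equidistant from [u] produces one. *)
Lemma alpha_d_neq0 : alpha d != 0.
Proof.
apply/eqP => ad; have [u [v [w [vw E]]]] := nonbipartite_edge e_conn e_sym nbip.
have wu := edge_dist_walk e_conn e_sym vw E.
have /eqP : \tr (A ^+ (dist e u v).*2.+1) = 0.
  apply: (alpha0_traces (leqnn d.+1)).1; last by rewrite ltnS dist_le_d.
  by move=> j; rewrite ltnS leq_eqVlt => /orP[/eqP->|/alpha0].
by rewrite mxtrace_exp_eq0 // => /forallP/(_ u); rewrite wu.
Qed.

Lemma entryB_parity i u v : (i <= d)%N -> odd (i + dist e u v) -> entry (B i) u v = 0.
Proof.
move=> id od; rewrite entry_mx_eval; apply: big1 => k _.
have [ok|ek] := boolP (odd (k + i)).
  rewrite p_parity ?mul0r // => j ji; apply: alpha0; lia.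
have/eqP-> : entry (A ^+ k) u v == 0; last by rewrite mulr0.
(* A walk of length [k] closed up by a geodesic would have odd length [k + dist e u v]. Since
   [dist e u v <= k <= d], oddness makes this less than [2d]. *)
rewrite entry_exp_eq0 //; apply/negP => wk.
have := ltn_ord k; rewrite [X in (_ < X)%N]size_p // => ki.
have := dist_le wk => dk.
have := @no_odd_walk u (k + dist e u v) ltac:(lia) ltac:(lia).
by rewrite (has_walk_cat wk) // has_walk_sym // dist_walk.
Qed.

Lemma dist_edge_neq u v w : (dist e u v < d)%N -> e v w -> dist e u w != dist e u v.
Proof.
move=> dd vw; apply/eqP => /(edge_dist_walk e_conn e_sym vw).
by apply/negP/no_odd_walk; lia.
Qed.

Lemma entryBd u v : (dist e u v < d)%N -> entry (B d) u v = 0.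
Proof.
move=> dd; have [od|ed] := boolP (odd (d + dist e u v)); first exact: entryB_parity.
have down0 : entry (if d is k.+1 then beta k *: B k else 0) u v = 0.
  case Ed: {1}d => [|k]; first exact: entry0.
  by rewrite entryZ (entryB_parity (i := k)) ?mulr0 //; lia.
have := congr1 (fun M => entry M u v) (recB (leqnn d)).
rewrite ltnn addr0 entryD entryZ entry_mulA // down0 add0r big1 => [|w vw].
  by move/esym/eqP; rewrite mulf_eq0 (negPf alpha_d_neq0) => /eqP.
(* Each neighbour of [v] lies at a distance from [u] of the other parity than [d]. *)
apply: entryB_parity => //; have := dist_edge_neq dd vw.
by have [] := dist_edge_cases e_conn e_sym u vw; lia.
Qed.

(** Downward induction on [i], through the recurrence for [B i.+1]. Neighbours of [v] are at
    distance at most [i] from [u], so every term except [beta i] times the wanted entry is already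
    known to vanish. *)
Lemma entryB_dist_lt i u v : (i <= d)%N -> (dist e u v < i)%N -> entry (B i) u v = 0.
Proof.
move: {2}(d - i)%N (erefl (d - i)%N) => m.
elim/ltn_ind: m i v => m IHm i v Em id di.
have [E|ni] := eqVneq i d; first by rewrite E in di *; apply: entryBd.
have i1 : (i < d)%N by lia.
have := congr1 (fun M => entry M u v) (recB i1).
rewrite entry_mulA // big1 => [|w vw].
  rewrite !entryD !entryZ (IHm (d - i.+1)%N _ i.+1) ?mulr0 ?addr0 //; try lia.
  have -> : entry (if (i.+1 < d)%N then gamma i.+2 *: B i.+2 else 0) u v = 0.
    case: ifP => i2; last by rewrite entry0.
    by rewrite entryZ (IHm (d - i.+2)%N _ i.+2) ?mulr0 //; lia.
  rewrite addr0 => /esym/eqP.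
  by rewrite mulf_eq0 (negPf (beta_neq0 i1)) => /eqP.
apply: (IHm (d - i.+1)%N) => //; first by lia.
by have := dist_edge e_conn u vw; lia.
Qed.

Lemma entryB_dist_neq i u v : (i <= d)%N -> dist e u v != i -> entry (B i) u v = 0.
Proof.
move=> id; case: ltngtP => // [lt_di _|lt_id _]; first exact: entryB_dist_lt.
by apply: entry_mx_eval_dist_gt; rewrite ?size_p.
Qed.

Local Notation J u v := (entry (\sum_(i < d.+1) B i) u v).

Lemma entryJ u v : J u v = entry (B (dist e u v)) u v.
Proof.
have dd : (dist e u v < d.+1)%N by rewrite ltnS dist_le_d.
rewrite entry_sum (bigD1 (Ordinal dd)) //= big1 ?addr0 // => i.
rewrite -val_eqE /= eq_sym => id; apply: entryB_dist_neq id.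
exact: (ltn_ord i).
Qed.

Lemma entryJ_diag u : J u u = 1.
Proof. by rewrite entryJ distxx // B0 entry1 eqxx. Qed.

Lemma entryJ_nbrs u v : \sum_(w | e v w) J u w = lam 0%N * J u v.
Proof. by rewrite -entry_mulA // sumB_mulA entryZ. Qed.

Lemma regular : exists kappa : R, forall u, \sum_(w | e u w) 1 = kappa.
Proof.
have [_ [v [w [vw _]]]] := nonbipartite_edge e_conn e_sym nbip.
have dist1 x y : e x y -> dist e x y = 1%N.
  move=> xy; have := @dist_le _ e x y 1; rewrite has_walk1 => /(_ xy).
  suff : dist e x y != 0%N by lia.
  by rewrite dist_eq0 //; apply: contraTneq xy => ->; rewrite e_irr.
have d1 : (1 <= d)%N by rewrite -(dist1 _ _ vw) dist_le_d.
exists (lam 0%N / lead_coef (p 1%N)) => u.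
have l1 : lead_coef (p 1%N) != 0 by rewrite lead_coef_eq0 -size_poly_gt0 size_p.
(* Compare the diagonal entries in [A J = lam_0 J]: each neighbour of [u] contributes the leading
   coefficient of [p 1]. *)
apply: (mulIf l1); rewrite mulfVK // -[RHS]mulr1 -{2}(entryJ_diag u) -entryJ_nbrs.
rewrite mulr_suml; apply: eq_bigr => x ux; rewrite mul1r entryJ dist1 //.
rewrite entry_mx_eval_dist_eq ?dist1 ?size_p // expr1.
by rewrite /entry mxE !enum_rankK ux mulr1.
Qed.

Lemma entryJ1 u v : J u v = 1.
Proof.
have [kappa reg] := regular.
have kL : kappa <= lam 0%N.
  have : eigenvalue A kappa.
    apply/eigenvalueP; exists (const_mx 1); last first.
      apply/negP => /eqP/rowP/(_ (enum_rank u))/eqP.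
      by rewrite !mxE oner_eq0.
    apply/rowP => i; rewrite !mxE mulr1 -(reg (enum_val i)) sum_enum_rank.
    rewrite [RHS]big_mkcond /=; apply: eq_bigr => x _.
    by rewrite !mxE enum_rankK e_sym mul1r; case: ifP.
  move=> /lamP.2[[|i] id ->] //; exact/ltW/lamP.1.
pose f v := J u v.
(* At a maximum [v0] of the row [f], the neighbour sum [lam_0 f(v0)] is at most [kappa f(v0)]. Hence
   [lam_0 = kappa], every neighbour attains the maximum, and [f] is constant by connectedness. *)
have [v0 _ fmax] := @arg_maxP _ _ _ u xpredT f isT.
have fv0 : 0 < f v0 by rewrite (lt_le_trans ltr01) // -(entryJ_diag u); apply: fmax.
have const x : f x = f v0 -> lam 0%N * f v0 = \sum_(w | e x w) f w.
  by move=> E; rewrite -E -entryJ_nbrs.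
have sum_max x : kappa * f v0 = \sum_(w | e x w) f v0.
  by rewrite -(reg x) mulr_suml; apply: eq_bigr => w _; rewrite mul1r.
have Lk : lam 0%N = kappa.
  apply/eqP; rewrite eq_le kL andbT -(ler_pM2r fv0) (const v0) // (sum_max v0).
  by apply: ler_sum => w _; apply: fmax.
have fconst k x : has_walk e v0 x k -> f x = f v0.
  elim: k x => [|k IHk] x; first by rewrite has_walk0 => /eqP->.
  rewrite has_walkS => /existsP[w /andP[/IHk fw wx]].
  have /eqP := const w fw; rewrite Lk (sum_max w) -subr_eq0 -sumrB => /eqP.
  move=> /psumr_eq0P/(_ x wx)/eqP; rewrite subr_eq0 => /(_ _)/eqP-> // y _.
  by rewrite subr_ge0; apply: fmax.
rewrite -(entryJ_diag u) -/(f v) -/(f u).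
by rewrite !(fconst _ _ (dist_walk e_conn v0 _)).
Qed.

Lemma entryB i u v : (i <= d)%N -> entry (B i) u v = (dist e u v == i)%:R.
Proof.
move=> id; have [E|/entryB_dist_neq-> //] := eqVneq.
by rewrite -E -entryJ entryJ1.
Qed.

(** The count is an entry of [B j *m A], which the recurrence writes through matrices whose entries
    depend on the distance alone. *)
Lemma count_nbrs u v u' v' j : dist e u v = dist e u' v' ->
  #|[set w | e v w & dist e u w == j]| = #|[set w | e v' w & dist e u' w == j]|.
Proof.
move=> E; case: (leqP j d) => jd; last first.
  have set_0 x y : [set w | e y w & dist e x w == j] = set0.
    apply/setP => w; rewrite !inE; apply/negP => /andP[_ /eqP dw].
    by have := dist_le_d x w; lia.
  by rewrite !set_0.
have cnt x y : entry (B j *m A) x y = #|[set w | e y w & dist e x w == j]|%:R :> R.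
  rewrite entry_mulA // -sum1_card natr_sum big_mkcond [RHS]big_mkcond /=.
  by apply: eq_bigr => w _; rewrite inE entryB //; case: (e y w) => //=; case: eqP.
apply/eqP; rewrite -(eqr_nat R) -!cnt recB // !entryD !entryZ !entryB // E.
apply/eqP; congr (_ + _ + _).
  by case: j jd {cnt} => [|k] kd; rewrite ?entry0 // !entryZ !entryB ?E // ltnW.
by case: ifP => jd'; rewrite ?entry0 // !entryZ !entryB // E.
Qed.

Lemma diameter_d : diameter e = d.
Proof.
apply/eqP; rewrite eqn_leq; apply/andP; split.
  by apply/bigmax_leqP => u _; apply/bigmax_leqP => v _; apply: dist_le_d.
(* If no pair were at distance [d], then [B d] would be zero, against its nonzero norm. *)
rewrite leqNgt; apply/negP => dd.
have Bd0 : B d = 0.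
  apply: eq_entry => u v; rewrite entryB // entry0.
  by case: eqP => // E; have := leq_diameter e u v; lia.
by have := normB_neq0 (leqnn d); rewrite Bd0 mul0mx mxtrace0 eqxx.
Qed.

Lemma alpha0_generalized_odd : generalized_odd e.
Proof.
split.
  split=> // i _ u v u' v' duv duv'.
  have E : dist e u v = dist e u' v' by rewrite duv duv'.
  rewrite /c_num /a_num /b_num -E duv; split; try exact: count_nbrs.
  (* [c_num] counts distance [i - 1], so the case [i = 0] is an empty set and is treated apart. *)
  case: i {duv'} duv => [|i] duv; last exact: count_nbrs.
  have set_0 x y : [set w | e y w & (dist e x w).+1 == 0%N] = set0.
    by apply/setP => w; rewrite !inE andbF.
  by rewrite !set_0.
have girth c : odd_cycle e c -> (2 * d + 1 <= size c)%N.
  move=> oc; have [u wu] := odd_cycle_walk oc; have [_ _ odc] := oc.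
  rewrite leqNgt; apply/negP => sc.
  by have := @no_odd_walk u (size c) odc ltac:(lia); rewrite wu.
rewrite diameter_d; split => //.
have [u [v [w [vw /(edge_dist_walk e_conn e_sym vw) wu]]]] :=
  nonbipartite_edge e_conn e_sym nbip.
(* The closed walk has length at most [2d + 1], so it yields an odd cycle of exactly the minimal
   length. *)
have [c oc sc] := odd_walk_cycle e_irr wu ltac:(lia).
exists c => //; have := girth c oc; have := @dist_le_d u v; lia.
Qed.

End AlphaZero.
End Predistance.

(** * The bound on [gamma d] and its equality case *)

Theorem theorem4p1 (R : rcfType) (T : finType) (e : rel T)
    (d : nat) (lam : nat -> R) (p : nat -> {poly R})
    (alpha beta gamma : nat -> R)
    (e_sym : symmetric e) (e_irr : irreflexive e)
    (e_conn : graph_connected e) (e_nbip : ~ bipartite e)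
    (lamP : distinct_eigenvalues e d lam)
    (pP : predistance_polys e d lam p)
    (abcP : preintersection_numbers d lam p alpha beta gamma) :
  ((forall i : nat, (i < d)%N -> 0 <= alpha i) ->
     gamma d >= - (\sum_(1 <= i < d.+1) lam i) /\
     (gamma d = - (\sum_(1 <= i < d.+1) lam i) <-> generalized_odd e)) /\
  ((exists2 g : nat, has_odd_girth e g & (2 * d - 1 <= g)%N) ->
     gamma d = - (\sum_(1 <= i < d.+1) lam i) -> generalized_odd e).
Proof.
have gd := gamma_d e_sym lamP pP abcP.
have alpha0_odd := alpha0_generalized_odd e_sym e_irr e_conn lamP pP abcP ^~ e_nbip.
have gdE : gamma d = - (\sum_(1 <= i < d.+1) lam i) -> \sum_(i < d) alpha i = 0.
  by rewrite gd -[RHS]addr0 => /addrI.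
split=> [alpha_ge0|[g girth dg] /gdE sum0].
  split; first by rewrite gd lerDl; apply: sumr_ge0 => i _; apply: alpha_ge0.
  split=> [/gdE sum0|odd_e].
    apply: alpha0_odd => i id.
    exact: (psumr_eq0P (fun (k : 'I_d) _ => alpha_ge0 k (ltn_ord k)) sum0
      (i := Ordinal id)).
  rewrite gd [X in _ + X]big1 ?addr0 // => i _.
  exact: (generalized_odd_alpha0 e_sym e_irr e_conn lamP pP abcP odd_e).
(* The odd-girth kills all [alpha j] with [j < d - 1]; the vanishing sum then kills the remaining
   [alpha (d - 1)], with no sign condition. *)
have low0 : forall j, (j < d.-1)%N -> alpha j = 0.
  by apply: (girth_alpha0 e_sym e_irr lamP pP abcP girth); lia.
apply: alpha0_odd => i id; have [/low0 //|di] := ltnP i d.-1.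
have E : d = i.+1 by lia.
move: sum0; rewrite E big_ord_recr /= big1 ?add0r // => k _.
by apply: low0; have := ltn_ord k; lia.
Qed.
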